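(* Let $n\ge m\ge k\ge 2$ be integers. If $A$ is an $m\times n$ (entrywise) nonnegative matrix with $\|A\|_{\max}\le 1$, and $\overline A:=J_{m,n}-A$, then $$\|A\|_{[k]}+\|J_{m,n}-A\|_{[k]}\le \sqrt{(k-1)mn}+\sqrt{mn}.$$ Equality holds if and only if $A$ is a regular $(0,1)$-matrix such that $$\sigma_1(A)=\sigma_1(\overline A)=\frac{\sqrt{mn}}{2}$$ and $$\sigma_2(A)=\cdots=\sigma_k(A)=\sigma_2(\overline A)=\cdots=\sigma_k(\overline A)=\frac12\sqrt{\frac{mn}{k-1}}.$$
   Context: For an $m\times n$ matrix $A=[a_{i,j}]$ with $n\ge m$, $\sigma_1(A)\ge\cdots\ge\sigma_m(A)$ denote its singular values, the Ky Fan $k$-norm is $\|A\|_{[k]}:=\sigma_1(A)+\cdots+\sigma_k(A)$, and $\|A\|_{\max}:=\max_{i,j}|a_{i,j}|$. $J_{m,n}$ is the $m\times n$ all-ones matrix. A matrix is called regular if all its row sums are equal and all its column sums are equal. *)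

(* Defs.v *)
From HB Require Import structures.
From mathcomp Require Import all_boot all_order all_algebra.
From mathcomp Require Import polyrcf.
From mathcomp Require Import reals matrix_normedtype.

Set Implicit Arguments.
Unset Strict Implicit.
Unset Printing Implicit Defensive.

Import Order.TTheory GRing.Theory Num.Theory.
Local Open Scope ring_scope.

(* Real eigenvalues in nonincreasing order, each repeated according to its
   multiplicity as a root of the characteristic polynomial. For a symmetric M
   of order m these are all the eigenvalues, so the sequence has size m. *)
Definition eigenvalues (R : realType) (m : nat) (M : 'M[R]_m) : seq R :=
  sort (fun x y => y <= x)
    (flatten [seq nseq (mup x (char_poly M)) x | x <- rootsR (char_poly M)]).

Definition singular_values (R : realType) (m n : nat) (A : 'M[R]_(m, n)) :
    seq R :=
  [seq Num.sqrt x | x <- eigenvalues (A *m A^T)].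

(* The index is 1-based: sigma 1 A is the largest singular value, and
   sigma i A is only meaningful for 1 <= i <= m. *)
Definition sigma (R : realType) (m n : nat) (i : nat) (A : 'M[R]_(m, n)) : R :=
  (singular_values A)`_i.-1.

Definition ky_fan_norm (R : realType) (m n : nat) (k : nat)
    (A : 'M[R]_(m, n)) : R :=
  \sum_(1 <= i < k.+1) sigma i A.

Definition all_ones (R : realType) (m n : nat) : 'M[R]_(m, n) := const_mx 1.

Definition regular_mx (R : realType) (m n : nat) (A : 'M[R]_(m, n)) : Prop :=
  (forall i i' : 'I_m, \sum_j A i j = \sum_j A i' j) /\
  (forall j j' : 'I_n, \sum_i A i j = \sum_i A i j').

Definition zero_one_mx (R : realType) (m n : nat) (A : 'M[R]_(m, n)) : Prop :=
  forall (i : 'I_m) (j : 'I_n), A i j = 0 \/ A i j = 1.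

(* Main.v *)
Require Import Defs.
From HB Require Import structures.
From mathcomp Require Import all_boot all_order all_algebra.
From mathcomp Require Import polyrcf complex.
From mathcomp Require Import reals matrix_normedtype.
From mathcomp Require Import ring lra.

Set Implicit Arguments.
Unset Strict Implicit.
Unset Printing Implicit Defensive.

Import Order.TTheory GRing.Theory Num.Theory.
Local Open Scope ring_scope.

(** Write p = sqrt (m n), q = sqrt (k - 1), B = J - A, and let s, t be the
    largest singular values of A and B.

    Testing A and B on the constant vectors gives
    s p + t p >= (sum of the entries of A) + (sum of the entries of B) = p^2,
    hence s + t >= p. On the other hand the squared singular values of A and B
    add up to the sum of all the a_ij^2 + (1 - a_ij)^2, that is, to
    p^2 - 2 (sum of the a_ij (1 - a_ij)) <= p^2. By Cauchy-Schwarz the left-hand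
    side is then at most x + sqrt ((k - 1) (2 p^2 - x^2)) with x = s + t, and
    this function decreases for x >= p, where it takes the value p + q p.

    To get the inequality and the equality case from a single computation, the
    estimates above are combined into one exact formula: [deficit_identity]
    writes the difference of the two sides as a sum of four terms, each
    nonnegative under the bounds of the previous paragraph. Equality makes each
    of them zero: the singular values of index 2..k all equal p / (2 q), the
    matrix A has only entries 0 and 1, s = t, and s + t = p. The last equation
    says that the constant vectors are singular vectors of A for s, which is
    regularity ([sum_entries_eq_regular]).

    The spectral input is that the characteristic polynomial of A A^T splits
    over R into the listed eigenvalues, and that the largest of them bounds the
    Rayleigh quotient ([gram_spectrum], [rayleigh_spec]). Both come from the
    unitary diagonalization of A A^T over R[i], whose diagonal is real. *)

(** * Spectrum of a real symmetric matrix *)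

Lemma char_poly_conj (R : comUnitRingType) (m : nat) (P D : 'M[R]_m) :
  P \in unitmx -> char_poly (invmx P *m D *m P) = char_poly D.
Proof.
move=> Pu; set Q := map_mx polyC P; set Q' := map_mx polyC (invmx P).
have QK : Q' *m Q = 1%:M by rewrite -map_mxM mulVmx // map_mx1.
rewrite /char_poly; have -> : char_poly_mx (invmx P *m D *m P) =
    Q' *m char_poly_mx D *m Q.
  rewrite /char_poly_mx mulmxBr mulmxBl !map_mxM /= scalar_mxC.
  by rewrite -[_ *m Q' *m Q]mulmxA QK mulmx1.
by rewrite !det_mulmx mulrAC -det_mulmx QK det1 mul1r.
Qed.

(** Over R[i], S = P^-1 D P with P unitary and D diagonal, and D is real because
    S is hermitian. The
    decomposition descends to R only through its two consequences below, which
    do not mention P: writing v = w P^-1, the quadratic form is the sum of the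
    d_i |v_i|^2 and the squared norm of w is the sum of the |v_i|^2. *)
Lemma symmetric_spectrum (R : rcfType) (m : nat) (S : 'M[R]_m) : S^T = S ->
  exists2 d : 'rV[R]_m, char_poly S = \prod_i ('X - (d 0 i)%:P) &
    forall c, (forall i, d 0 i <= c) ->
      forall w : 'rV_m, (w *m S *m w^T) 0 0 <= c * (w *m w^T) 0 0.
Proof.
move=> symS; pose rc := real_complex R; pose SC := map_mx rc S.
have realC (p q : nat) (M : 'M[R]_(p, q)) :
    map_mx Num.conj (map_mx rc M) = map_mx rc M.
  by apply/matrixP => i j; rewrite !mxE; exact: conjc_real.
have hermS : SC \is hermsymmx.
  apply/is_hermitianmxP; rewrite expr0 scale1r /SC -map_trmx realC.
  by rewrite map_trmx symS.
have /orthomx_spectralP := hermitian_normalmx hermS.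
have /mxOverP realD := hermitian_spectral_diag_real hermS.
set P := spectralmx SC; set D := spectral_diag SC => SCE.
pose d : 'rV[R]_m := \row_i complex.Re (D 0 i).
have dE : D = map_mx rc d.
  apply/matrixP => i j; rewrite ord1 !mxE; apply/esym/RRe_real; exact: realD.
have Punit : P \in unitmx := spectral_unit SC.
exists d.
  apply: (@map_poly_inj _ _ rc).
  rewrite map_char_poly -/SC SCE char_poly_conj // char_poly_trig; last first.
    exact/diag_mx_is_trig.
  rewrite rmorph_prod /=; apply: eq_bigr => i _.
  by rewrite map_polyXsubC mxE eqxx dE mxE.
move=> c d_le w.
pose v := map_mx rc w *m invmx P.
have vP : v *m P = map_mx rc w by rewrite mulmxKV.
have Pwt : P *m map_mx rc w^T = map_mx Num.conj v^T.
  rewrite /v invmx_unitary ?spectral_unitarymx // trmx_mul map_mxM.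
  rewrite -map_trmx trmxK -map_mx_comp (map_mx_id (@conjCK _)).
  by rewrite map_trmx realC.
have rcE (M : 'M[R]_1) : rc (M 0 0) = (map_mx rc M) 0 0 by rewrite mxE.
rewrite -subr_ge0 -ler0c (rmorphB (real_complex R)) rmorphM /= -!/(rc _).
rewrite !rcE !map_mxM /=.
rewrite -/SC SCE -{1}vP -(mulmxA v) Pwt !mulmxA -/v -(mulmxA _ P) Pwt.
rewrite !mxE mulr_sumr -sumrB; apply: sumr_ge0 => j _.
rewrite mul_mx_diag !mxE dE mxE.
set z := \sum_(_ | _) _.
have -> : rc c * (z * z^*) - z * rc (d 0 j) * z^* =
    (rc c - rc (d 0 j)) * (z * z^*) by ring.
by rewrite mulr_ge0 ?mul_conjC_ge0 // subr_ge0 lecR.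
Qed.

(** Once the characteristic polynomial is known to split, reading off its
    roots with their multiplicities loses nothing. *)
Lemma perm_eigenvalues (R : realType) (m : nat) (M : 'M[R]_m) (s : seq R) :
  char_poly M = \prod_(x <- s) ('X - x%:P) -> perm_eq (eigenvalues M) s.
Proof.
move=> splitM; have p0 : char_poly M != 0 by exact/monic_neq0/char_poly_monic.
rewrite perm_sort; apply/allP => y _ /=; apply/eqP.
rewrite count_flatten -map_comp sumnE big_map -mu_prod_XsubC -splitM.
under eq_bigr => x _ do rewrite /= count_nseq /=.
have [y_root | y_nroot] := boolP (y \in rootsR (char_poly M)).
  rewrite (bigD1_seq y) ?uniq_roots //= eqxx mul1n big1 ?addn0 // => x.
  by move=> /negPf ->.
rewrite big_seq big1 => [|x x_root]; last first.
  by case: eqP x_root y_nroot => [->|] // ->.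
rewrite mupNroot //; apply: contra y_nroot => rooty.
by rewrite -roots_on_rootsR //= in_itv.
Qed.

Lemma norm2_ge0 (R : realFieldType) (m : nat) (w : 'rV[R]_m) :
  0 <= (w *m w^T) 0 0.
Proof. by rewrite mxE sumr_ge0 // => i _; rewrite mxE -expr2 sqr_ge0. Qed.

Lemma norm2_eq0 (R : realFieldType) (m : nat) (w : 'rV[R]_m) :
  (w *m w^T) 0 0 = 0 -> w = 0.
Proof.
rewrite mxE => /eqP; rewrite psumr_eq0 => [/allP w0|i _]; last first.
  by rewrite mxE -expr2 sqr_ge0.
apply/rowP => j; have := w0 j (mem_index_enum j).
by rewrite !mxE /= mulf_eq0 orbb => /eqP.
Qed.

(** Moving from w in the direction - w M would make the form negative unless
    w M = 0. This turns equality in the Rayleigh bound into an eigenvector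
    equation. *)
Lemma psd_isotropic (R : realFieldType) (m : nat)
    (M : 'M[R]_m) (w : 'rV_m) : M^T = M ->
    (forall v : 'rV_m, 0 <= (v *m M *m v^T) 0 0) ->
  (w *m M *m w^T) 0 0 = 0 -> w *m M = 0.
Proof.
move=> symM psd w0; set z := w *m M; apply: norm2_eq0.
set N := (z *m z^T) 0 0; pose Q := (z *m M *m z^T) 0 0.
have N_ge0 : 0 <= N := norm2_ge0 z; have Q_ge0 : 0 <= Q := psd z.
have wz : (w *m M *m z^T) 0 0 = N by [].
have zw : (z *m M *m w^T) 0 0 = N by rewrite /N trmx_mul symM mulmxA.
have quad t : 0 <= - 2 * t * N + t ^+ 2 * Q.
  have := psd (w - t *: z).
  rewrite [(w - _)^T]linearB /= [(t *: z)^T]linearZ /=.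
  rewrite !mulmxBl !mulmxBr.
  rewrite -!scalemxAl -!scalemxAr.
  have -> (a b c d : 'M[R]_1) : (a - t *: b - (t *: c - t *: (t *: d))) 0 0 =
      a 0 0 - t * (b 0 0) - t * c 0 0 + t ^+ 2 * d 0 0 by rewrite !mxE; ring.
  by rewrite w0 wz zw -/Q; lra.
(* For Q > 0 the quadratic is least at t = N / Q; Q + 1 in place of Q avoids
   dividing by zero and still gives a negative value when N > 0. *)
have := quad (N / (Q + 1)); have Q1 : Q + 1 != 0 by rewrite gt_eqF // ltr_wpDl.
have -> : - 2 * (N / (Q + 1)) * N + (N / (Q + 1)) ^+ 2 * Q =
    - (N / (Q + 1)) ^+ 2 * (Q + 2) by field.
rewrite mulNr oppr_ge0 pmulr_lle0 ?ltr_wpDl // => sq_le0.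
have /eqP : (N / (Q + 1)) ^+ 2 = 0 by apply/le_anti; rewrite sq_le0 sqr_ge0.
by rewrite sqrf_eq0 mulf_eq0 invr_eq0 (negPf Q1) orbF => /eqP.
Qed.

(** * Spectrum of a Gram matrix *)

Definition frobenius_sqr (R : pzRingType) (m n : nat) (A : 'M[R]_(m, n)) : R :=
  \sum_i \sum_j A i j ^+ 2.

Lemma trace_gram (R : comPzRingType) (m n : nat) (A : 'M[R]_(m, n)) :
  \tr (A *m A^T) = frobenius_sqr A.
Proof.
by apply: eq_bigr => i _; rewrite mxE; apply: eq_bigr => j _; rewrite mxE expr2.
Qed.

Section Gram.

Variables (R : realType) (m n : nat).
Implicit Type A : 'M[R]_(m, n).

Local Notation spec A := (eigenvalues (A *m A^T)).

Lemma gram_spectrum A :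
  char_poly (A *m A^T) = \prod_(x <- spec A) ('X - x%:P) /\
  forall c, {in spec A, forall x, x <= c} ->
    forall w : 'rV_m, (w *m (A *m A^T) *m w^T) 0 0 <= c * (w *m w^T) 0 0.
Proof.
have [|d dE dP] := @symmetric_spectrum R m (A *m A^T).
  by rewrite trmx_mul trmxK.
have perm_d : perm_eq (spec A) [seq d 0 i | i <- enum 'I_m].
  by apply: perm_eigenvalues; rewrite dE big_map big_enum.
split=> [|c c_ge]; first by rewrite dE (perm_big _ perm_d) big_map big_enum.
by apply: dP => i; apply: c_ge; rewrite (perm_mem perm_d) map_f ?mem_enum.
Qed.

Lemma size_spec A : size (spec A) = m.
Proof.
have [/(congr1 (size \o val))/= + _] := gram_spectrum A.
by rewrite size_char_poly size_prod_XsubC => -[].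
Qed.

Lemma sorted_spec A : sorted (fun x y => y <= x) (spec A).
Proof. by apply: sort_sorted => x y; exact: le_total. Qed.

(** For m > 0 both sides are, up to sign, the coefficient of degree m - 1 of the
    characteristic polynomial of A A^T. *)
Lemma sum_spec A : \sum_(x <- spec A) x = frobenius_sqr A.
Proof.
have [m0|m_gt0] := posnP m.
  have /size0nil -> : size (spec A) = 0%N by rewrite size_spec.
  rewrite big_nil /frobenius_sqr big1 // => -[i i_lt].
  by exfalso; rewrite m0 in i_lt.
have [charE _] := gram_spectrum A.
have := @coefPn_prod_XsubC _ (spec A); rewrite size_spec -charE -lt0n.
by move=> /(_ m_gt0); rewrite char_poly_trace // trace_gram => /oppr_inj.
Qed.

(** If v (A A^T) = x v then x |v|^2 = |v A|^2. *)
Lemma spec_ge0 A x : x \in spec A -> 0 <= x.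
Proof.
move=> xA; have [charE _] := gram_spectrum A.
have: eigenvalue (A *m A^T) x.
  by rewrite eigenvalue_root_char charE root_prod_XsubC.
case/eigenvalueP => v vA v_neq0.
have v_gt0 : 0 < (v *m v^T) 0 0.
  by rewrite lt_def norm2_ge0 andbT; apply: contra_neq v_neq0 => /norm2_eq0.
rewrite -(pmulr_lge0 _ v_gt0).
have -> : x * (v *m v^T) 0 0 = ((v *m A) *m (v *m A)^T) 0 0.
  by rewrite trmx_mul !mulmxA -(mulmxA v) vA -scalemxAl [in RHS]mxE.
exact: norm2_ge0.
Qed.

Lemma rayleigh_spec A (w : 'rV_m) :
  (w *m (A *m A^T) *m w^T) 0 0 <= (spec A)`_0 * (w *m w^T) 0 0.
Proof.
have [_] := gram_spectrum A; apply=> _ /(nthP 0)[j j_lt <-].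
have ge_trans : transitive (fun x y : R => y <= x).
  by move=> y x z yx zy; exact: le_trans zy yx.
rewrite (sorted_leq_nth ge_trans (@lexx _ R) 0 (sorted_spec A)) // inE.
by rewrite (leq_ltn_trans _ j_lt).
Qed.

End Gram.

(** * Singular values and the sum of the entries *)

Section SingularValues.

Variables (R : realType) (m n : nat).
Implicit Type A : 'M[R]_(m, n).

Lemma sigma_ge0 A i : 0 <= sigma i A.
Proof.
rewrite /sigma /singular_values.
have [lt_i|ge_i] := ltnP i.-1 (size (eigenvalues (A *m A^T))).
  by rewrite (nth_map 0) ?sqrtr_ge0.
by rewrite nth_default ?size_map.
Qed.

Lemma sqr_sigma A i : (i.-1 < m)%N ->
  sigma i A ^+ 2 = (eigenvalues (A *m A^T))`_i.-1.
Proof.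
move=> lt_i; rewrite -(size_spec A) in lt_i.
rewrite /sigma /singular_values (nth_map 0) // sqr_sqrtr //.
by rewrite (@spec_ge0 _ _ _ A) ?mem_nth.
Qed.

Lemma sum_sqr_sigma_le A k : (k <= m)%N ->
  \sum_(1 <= i < k.+1) sigma i A ^+ 2 <= frobenius_sqr A.
Proof.
move=> k_le; rewrite -sum_spec [leRHS](big_nth 0) size_spec big_add1 /=.
rewrite [leRHS](big_cat_nat (n := k)) //=.
rewrite [leLHS]big_nat [X in _ <= X + _]big_nat.
rewrite (eq_bigr (fun i => (eigenvalues (A *m A^T))`_i)) => [|i /andP[_ lt_i]].
  rewrite lerDl big_nat; apply: sumr_ge0 => i /andP[_ lt_i].
  by rewrite (@spec_ge0 _ _ _ A) // mem_nth ?size_spec.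
by rewrite sqr_sigma //= (leq_trans lt_i).
Qed.

Definition sum_entries A : R := \sum_i \sum_j A i j.

(** The gap in the Cauchy-Schwarz inequality between the column sums c and the
    constant vector: n times the squared distance from c to the
    constant vector with the same sum. *)
Lemma sqr_sum_entries_defect A : (0 < n)%N ->
  let c j := \sum_i A i j in
  n%:R * (\sum_j c j ^+ 2) - sum_entries A ^+ 2 =
    n%:R * \sum_j (c j - sum_entries A / n%:R) ^+ 2.
Proof.
move=> n_gt0 c; have n0 : n%:R != 0 :> R by rewrite pnatr_eq0 -lt0n.
have sumE : sum_entries A = \sum_j c j by rewrite /sum_entries exchange_big.
under [in RHS]eq_bigr => j _ do rewrite sqrrB.
rewrite big_split sumrB /= sumr_const card_ord sumrMnl -mulr_suml -sumE.
by rewrite -[_ ^+ 2 *+ n]mulr_natl; field.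
Qed.

Let one : 'rV[R]_m := const_mx 1.

Lemma one_gram A :
  (one *m (A *m A^T) *m one^T) 0 0 = \sum_j (\sum_i A i j) ^+ 2.
Proof.
have -> : one *m (A *m A^T) *m one^T = (one *m A) *m (one *m A)^T.
  by rewrite trmx_mul !mulmxA.
rewrite mxE; apply: eq_bigr => j _; rewrite !mxE -expr2; congr (_ ^+ 2).
by apply: eq_bigr => i _; rewrite mxE mul1r.
Qed.

Lemma norm2_one : (one *m one^T) 0 0 = m%:R.
Proof.
rewrite mxE (eq_bigr (fun=> 1)) => [|i _]; last by rewrite !mxE mulr1.
by rewrite sumr_const card_ord.
Qed.

Hypotheses (m_gt0 : (0 < m)%N) (n_gt0 : (0 < n)%N).

Lemma sum_sqr_col_le A :
  \sum_j (\sum_i A i j) ^+ 2 <= sigma 1 A ^+ 2 * m%:R.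
Proof. by rewrite -one_gram -norm2_one sqr_sigma // rayleigh_spec. Qed.

Lemma sqr_sum_entries_le A :
  sum_entries A ^+ 2 <= sigma 1 A ^+ 2 * (m%:R * n%:R).
Proof.
apply: (@le_trans _ _ (n%:R * (\sum_j (\sum_i A i j) ^+ 2))).
  rewrite -subr_ge0 sqr_sum_entries_defect // mulr_ge0 //.
  by apply: sumr_ge0 => j _; rewrite sqr_ge0.
by rewrite mulrA [leRHS]mulrC ler_pM2l ?ltr0n // sum_sqr_col_le.
Qed.

(** The largest singular value bounds the bilinear form of A at the two
    constant vectors, whose norms multiply to sqrt (m n). *)
Lemma sum_entries_le A : sum_entries A <= sigma 1 A * Num.sqrt (m%:R * n%:R).
Proof.
have rhs_ge0 : 0 <= sigma 1 A * Num.sqrt (m%:R * n%:R).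
  by rewrite mulr_ge0 ?sigma_ge0 ?sqrtr_ge0.
have [tot_ge0|/ltW tot_le0] := leP 0 (sum_entries A); last first.
  exact: le_trans rhs_ge0.
rewrite -ler_sqr ?nnegrE // exprMn sqr_sqrtr ?mulr_ge0 ?ler0n //.
exact: sqr_sum_entries_le.
Qed.

(** Let e be the all-ones row and s the largest singular value of A. The bound
    [sum_entries_le] chains two inequalities: Cauchy-Schwarz for the column sums
    e A, whose equality case makes the column sums equal, and the Rayleigh bound
    for A A^T at e, whose equality case makes e an eigenvector. Then
    e A A^T = s^2 e, while e A is constant and nonzero, so the row sums of A are
    equal as well. *)
Lemma sum_entries_eq_regular A : 0 < sigma 1 A ->
  sum_entries A = sigma 1 A * Num.sqrt (m%:R * n%:R) -> regular_mx A.
Proof.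
move=> s_gt0 totE; pose c j := \sum_i A i j.
have n0 : n%:R != 0 :> R by rewrite pnatr_eq0 -lt0n.
have tot2 : sum_entries A ^+ 2 = sigma 1 A ^+ 2 * (m%:R * n%:R).
  by rewrite totE exprMn sqr_sqrtr ?mulr_ge0 ?ler0n.
have tot_neq0 : sum_entries A != 0.
  by rewrite totE gt_eqF // mulr_gt0 // sqrtr_gt0 mulr_gt0 ?ltr0n.
have defect_ge0 : 0 <= \sum_j (c j - sum_entries A / n%:R) ^+ 2.
  by apply: sumr_ge0 => j _; rewrite sqr_ge0.
have col_le := sum_sqr_col_le A.
have n_pos : 0 < n%:R :> R by rewrite ltr0n.
have defectE := sqr_sum_entries_defect A n_gt0.
have col2 : \sum_j c j ^+ 2 = sigma 1 A ^+ 2 * m%:R.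
  apply/le_anti; rewrite col_le /= -(ler_pM2l n_pos) mulrC -mulrA -tot2.
  by rewrite -subr_ge0 defectE mulr_ge0.
(* The Cauchy-Schwarz gap vanishes. *)
have colE j : c j = sum_entries A / n%:R.
  pose gap j := (c j - sum_entries A / n%:R) ^+ 2.
  have := psumr_eq0P (P := xpredT) (F := gap).
  move=> /(_ (fun i _ => sqr_ge0 _)) defect0.
  apply/eqP; rewrite -subr_eq0 -sqrf_eq0; apply/eqP/defect0 => //.
  by apply: (mulfI n0); rewrite -defectE col2 tot2 mulr0; ring.
have rowE i : \sum_j A i j = sigma 1 A ^+ 2 * (n%:R / sum_entries A).
  (* The form of M is nonnegative and vanishes at the all-ones row. *)
  pose M := (sigma 1 A ^+ 2)%:M - A *m A^T.
  have MT : M^T = M by rewrite /M linearB /= tr_scalar_mx trmx_mul trmxK.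
  have formM (w : 'rV_m) : (w *m M *m w^T) 0 0 =
      sigma 1 A ^+ 2 * (w *m w^T) 0 0 - (w *m (A *m A^T) *m w^T) 0 0.
    by rewrite /M mulmxBr mulmxBl mul_mx_scalar -scalemxAl !mxE.
  have psdM (w : 'rV_m) : 0 <= (w *m M *m w^T) 0 0.
    by rewrite formM subr_ge0 sqr_sigma // rayleigh_spec.
  have /(psd_isotropic MT psdM)/rowP/(_ i) : (one *m M *m one^T) 0 0 = 0.
    by rewrite formM one_gram norm2_one col2 subrr.
  rewrite /M mulmxBr mul_mx_scalar mulmxA !mxE mulr1 => /eqP.
  rewrite subr_eq0 => /eqP ->.
  rewrite [in RHS](eq_bigr (fun j => sum_entries A / n%:R * A i j)) => [|j _];
    last first.
    rewrite !mxE -(colE j); congr (_ * _).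
    by apply: eq_bigr => l _; rewrite mxE mul1r.
  by rewrite -mulr_sumr; field; rewrite tot_neq0.
by split=> [i i'|j j']; rewrite ?rowE // -!/(c _) !colE.
Qed.

End SingularValues.

(** * Complementary matrices and the deficit *)

(** Entrywise, a^2 + (1 - a)^2 = 1 - 2 a (1 - a). *)
Lemma frobenius_sqr_complement (R : realType) (m n : nat) (A : 'M[R]_(m, n)) :
  frobenius_sqr A + frobenius_sqr (all_ones R m n - A) =
    m%:R * n%:R - 2 * \sum_i \sum_j A i j * (1 - A i j).
Proof.
rewrite /frobenius_sqr -big_split /= mulr_sumr.
have -> : m%:R * n%:R = \sum_(i < m) \sum_(j < n) (1 : R).
  by rewrite !sumr_const !card_ord -mulrnA mulnC natrM.
rewrite -sumrB; apply: eq_bigr => i _; rewrite -big_split mulr_sumr -sumrB /=.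
by apply: eq_bigr => j _; rewrite !mxE; ring.
Qed.

Lemma sum_entries_complement (R : realType) (m n : nat) (A : 'M[R]_(m, n)) :
  sum_entries A + sum_entries (all_ones R m n - A) = m%:R * n%:R.
Proof.
have -> : m%:R * n%:R = \sum_(i < m) \sum_(j < n) (1 : R).
  by rewrite !sumr_const !card_ord -mulrnA mulnC natrM.
rewrite /sum_entries -big_split; apply: eq_bigr => i _; rewrite -big_split.
by apply: eq_bigr => j _; rewrite !mxE /= addrC subrK.
Qed.

(** Here q p + p is the claimed bound and s, x_2, ..., x_k and t, y_2, ..., y_k
    stand for the singular values. The value c is the one that the x_i and y_i
    must take in the extremal case. The first term is the error of the tangent
    estimate x <= (x^2 + c^2) / (2 c), which replaces Cauchy-Schwarz. Up to
    the factor 1 / (2 c), the second is the unused part of the budget p^2 for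
    the squares and the third is the error of s^2 + t^2 >= (s + t)^2 / 2. The
    fourth is what remains, a quadratic in s + t that vanishes at s + t = p. *)
Lemma deficit_identity (R : realFieldType) (p q s t : R) (k : nat)
    (x y : nat -> R) :
    0 < p -> 0 < q -> (0 < k)%N -> q ^+ 2 = k%:R - 1 ->
    let c := p / (2 * q) in
  q * p + p - (s + \sum_(2 <= i < k.+1) x i + (t + \sum_(2 <= i < k.+1) y i)) =
    (\sum_(2 <= i < k.+1) ((x i - c) ^+ 2 + (y i - c) ^+ 2)) / (2 * c) +
    (p ^+ 2 - (s ^+ 2 + \sum_(2 <= i < k.+1) x i ^+ 2)
            - (t ^+ 2 + \sum_(2 <= i < k.+1) y i ^+ 2)) / (2 * c) +
    (s - t) ^+ 2 / (4 * c) +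
    (s + t - p) * (q * (s + t + p) / (2 * p) - 1).
Proof.
move=> p_gt0 q_gt0 k_gt0 q2 c.
have [p0 q0] := (lt0r_neq0 p_gt0, lt0r_neq0 q_gt0).
have sum_shift (z : nat -> R) : \sum_(2 <= i < k.+1) (z i - c) ^+ 2 =
    \sum_(2 <= i < k.+1) z i ^+ 2 - 2 * c * \sum_(2 <= i < k.+1) z i +
    q ^+ 2 * c ^+ 2.
  under eq_bigr => i _ do rewrite sqrrB.
  rewrite big_split sumrB /= sumrMnl -mulr_suml sumr_const_nat q2.
  rewrite -[_ ^+ 2 *+ _]mulr_natl subSS natrB //.
  by rewrite -[_ *+ 2]mulr_natl; ring.
rewrite big_split /= !sum_shift /c.
move: (\sum_(2 <= i < k.+1) x i) (\sum_(2 <= i < k.+1) y i) => X Y.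
move: (\sum_(2 <= i < k.+1) x i ^+ 2) (\sum_(2 <= i < k.+1) y i ^+ 2) => X2 Y2.
by field; rewrite p0 q0.
Qed.

Theorem theorem3p21 (R : realType) (m n k : nat)
    (hk : (2 <= k)%N) (hkm : (k <= m)%N) (hmn : (m <= n)%N)
    (A : 'M[R]_(m, n))
    (A_ge0 : forall (i : 'I_m) (j : 'I_n), 0 <= A i j)
    (A_max : mx_norm A <= 1) :
  let B := all_ones R m n - A in
  let lhs := ky_fan_norm k A + ky_fan_norm k B in
  let rhs := Num.sqrt ((k%:R - 1) * m%:R * n%:R) + Num.sqrt (m%:R * n%:R) in
  lhs <= rhs /\
  (lhs = rhs <->
   [/\ regular_mx A,
       zero_one_mx A,
       sigma 1 A = Num.sqrt (m%:R * n%:R) / 2 /\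
       sigma 1 B = Num.sqrt (m%:R * n%:R) / 2
     & forall i : nat, (2 <= i <= k)%N ->
       sigma i A = 2^-1 * Num.sqrt (m%:R * n%:R / (k%:R - 1)) /\
       sigma i B = 2^-1 * Num.sqrt (m%:R * n%:R / (k%:R - 1))]).
Proof.
move=> B lhs rhs.
have m_gt0 : (0 < m)%N by rewrite (leq_trans _ hkm) // ltnW.
have n_gt0 : (0 < n)%N := leq_trans m_gt0 hmn.
have k_gt0 : (0 < k)%N := ltnW hk.
have A_le1 i j : A i j <= 1.
  apply: le_trans A_max; rewrite mx_normrE -(ger0_norm (A_ge0 i j)).
  exact: (le_bigmax _ (fun ij : 'I_m * 'I_n => `|A ij.1 ij.2|) (i, j)).
pose mn : R := m%:R * n%:R; pose p := Num.sqrt mn.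
pose q := Num.sqrt (k%:R - 1 : R).
have mn_gt0 : 0 < mn by rewrite mulr_gt0 ?ltr0n.
have p_gt0 : 0 < p by rewrite sqrtr_gt0.
have p2 : p ^+ 2 = mn by rewrite sqr_sqrtr // ltW.
have k1_ge1 : 1 <= k%:R - 1 :> R by rewrite lerBrDr -[1 + 1]/(2%:R) ler_nat.
have k1_ge0 : 0 <= k%:R - 1 :> R := le_trans ler01 k1_ge1.
have q2 : q ^+ 2 = k%:R - 1 by rewrite sqr_sqrtr.
have q_ge1 : 1 <= q by rewrite -(sqrtr1 R) ler_wsqrtr.
have q_gt0 : 0 < q := lt_le_trans ltr01 q_ge1.
have rhsE : rhs = q * p + p by rewrite /rhs -mulrA (sqrtrM _ k1_ge0).
pose c := p / (2 * q).
have cE : 2^-1 * Num.sqrt (m%:R * n%:R / (k%:R - 1)) = c.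
  rewrite (sqrtrM _ (ltW mn_gt0)) sqrtrV // -/p -/q /c.
  by field; rewrite gt_eqF.
have c_gt0 : 0 < c by rewrite divr_gt0 ?mulr_gt0.
have kyfanE (M : 'M[R]_(m, n)) :
    ky_fan_norm k M = sigma 1 M + \sum_(2 <= i < k.+1) sigma i M.
  by rewrite /ky_fan_norm big_ltn.
have frobP (M : 'M[R]_(m, n)) :
    sigma 1 M ^+ 2 + \sum_(2 <= i < k.+1) sigma i M ^+ 2 <= frobenius_sqr M.
  by apply: le_trans (sum_sqr_sigma_le M hkm); rewrite [leRHS]big_ltn.
rewrite cE -/mn -/p.
have tot := sum_entries_complement A; rewrite -/B -/mn -p2 in tot.
have totA := sum_entries_le m_gt0 n_gt0 A.
have totB := sum_entries_le m_gt0 n_gt0 B.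
rewrite -/mn -/p in totA totB.
have frobE := frobenius_sqr_complement A; rewrite -/B -/mn -p2 in frobE.
have offset_ge0 i j : 0 <= A i j * (1 - A i j) by rewrite mulr_ge0 ?subr_ge0.
have offset_sum_ge0 : 0 <= \sum_i \sum_j A i j * (1 - A i j).
  by apply: sumr_ge0 => i _; apply: sumr_ge0.
have := @deficit_identity R p q (sigma 1 A) (sigma 1 B) k
  (fun i => sigma i A) (fun i => sigma i B).
move=> /(_ p_gt0 q_gt0 k_gt0 q2) /=; rewrite -!kyfanE -rhsE -/lhs -/c.
set s := sigma 1 A; set t := sigma 1 B.
set D1 := \sum_(2 <= i < k.+1) _; set D2 := p ^+ 2 - _ - _.
set F := q * _ / _ - 1 => deficitE.
have st_ge : p <= s + t.
  by rewrite -(ler_pM2r p_gt0) -expr2 -tot mulrDl lerD.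
have term_ge0 i : 0 <= (sigma i A - c) ^+ 2 + (sigma i B - c) ^+ 2.
  by rewrite addr_ge0 ?sqr_ge0.
have D1_ge0 : 0 <= D1 by apply: sumr_ge0.
have frobA := frobP A; have frobB := frobP B.
have D2_ge : 2 * \sum_i \sum_j A i j * (1 - A i j) <= D2.
  rewrite /D2; rewrite -/s in frobA; rewrite -/t in frobB; lra.
have D2_ge0 : 0 <= D2 by apply: le_trans D2_ge; rewrite mulr_ge0.
(* Since q >= 1, the fourth term of the deficit is at least a positive multiple
   of (s + t - p)^2. When k = 2 it has no linear part at s + t = p, so this
   square is what forces s + t = p in the equality case. *)
have F_ge : (s + t - p) / (2 * p) <= F.
  rewrite /F -subr_ge0.
  have -> : q * (s + t + p) / (2 * p) - 1 - (s + t - p) / (2 * p) =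
     (q - 1) * (s + t + p) / (2 * p) by field; rewrite gt_eqF.
  by rewrite divr_ge0 ?mulr_ge0 ?subr_ge0 // ?addr_ge0 ?sigma_ge0 //;
    exact: ltW.
have E1_ge0 : 0 <= D1 / (2 * c) by rewrite divr_ge0 // mulr_ge0 // ltW.
have E2_ge0 : 0 <= D2 / (2 * c) by rewrite divr_ge0 // mulr_ge0 // ltW.
have E3_ge0 : 0 <= (s - t) ^+ 2 / (4 * c).
  by rewrite divr_ge0 ?sqr_ge0 // mulr_ge0 // ltW.
have st0 : 0 <= s + t - p by rewrite subr_ge0.
have E4_ge : (s + t - p) ^+ 2 / (2 * p) <= (s + t - p) * F.
  by rewrite expr2 -mulrA ler_wpM2l.
have E4_lb : 0 <= (s + t - p) ^+ 2 / (2 * p).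
  by rewrite divr_ge0 ?sqr_ge0 // mulr_ge0 // ltW.
split; first by rewrite -subr_ge0 deficitE !addr_ge0 // (le_trans E4_lb).
split=> [lhsE|[_ _ [sE tE] sigmaE]]; last first.
  rewrite /lhs !kyfanE -/s -/t sE tE rhsE.
  have sum_c (z : nat -> R) : (forall i, (2 <= i <= k)%N -> z i = c) ->
      \sum_(2 <= i < k.+1) z i = q ^+ 2 * c.
    move=> zE; rewrite big_nat (eq_bigr (fun=> c)) => [|i /zE //].
    by rewrite -big_nat sumr_const_nat subSS -mulr_natl natrB ?q2.
  rewrite !sum_c => [|i /sigmaE[]|i /sigmaE[]] //.
  by rewrite /c; field; rewrite gt_eqF.
rewrite lhsE subrr in deficitE.
have cancel_div (z d : R) : 0 < d -> z / d = 0 -> z = 0.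
  by move=> d_gt0 /(canRL (divfK (lt0r_neq0 d_gt0))); rewrite mul0r.
have D1_0 : D1 = 0.
  by apply: (@cancel_div _ (2 * c)); [rewrite mulr_gt0 | lra].
have D2_0 : D2 = 0.
  by apply: (@cancel_div _ (2 * c)); [rewrite mulr_gt0 | lra].
have st : s = t.
  apply/eqP; rewrite -subr_eq0 -sqrf_eq0; apply/eqP.
  by apply: (@cancel_div _ (4 * c)); [rewrite mulr_gt0 | lra].
have stp : s + t = p.
  apply/eqP; rewrite -subr_eq0 -sqrf_eq0; apply/eqP.
  by apply: (@cancel_div _ (2 * p)); [rewrite mulr_gt0 | lra].
have sE : s = p / 2 by lra.
have offset0 : \sum_i \sum_j A i j * (1 - A i j) = 0 by lra.
split.
- apply: sum_entries_eq_regular => //; first by rewrite -/s sE divr_gt0.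
  rewrite -/mn -/p -/s; apply/le_anti; rewrite totA /=.
  have : s * p + t * p = p ^+ 2 by rewrite -mulrDl stp expr2.
  rewrite -/s -/t in totA totB; lra.
- move=> i j.
  have row0 : \sum_j A i j * (1 - A i j) = 0.
    by apply: (psumr_eq0P _ offset0) => // l _; apply: sumr_ge0.
  have /eqP : A i j * (1 - A i j) = 0 by apply: (psumr_eq0P _ row0).
  by rewrite mulf_eq0 subr_eq0 => /orP[/eqP ->|/eqP <-]; [left | right].
- by split=> //; rewrite -st.
move=> i i_in; move/eqP: D1_0.
rewrite /D1 big_nat psumr_eq0 // => /allP/(_ i).
rewrite mem_index_iota ltnS i_in => /(_ isT) /=.
by rewrite paddr_eq0 ?sqr_ge0 // !sqrf_eq0 !subr_eq0 => /andP[/eqP-> /eqP->].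
Qed.
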